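(* For each $n\geq 1$ let $X_n:(\Omega_n,\mathcal{A}_n,\mathbb{P}_n)\to\mathbb{R}$ be a real random variable on a probability space, and let $X_\infty:(\Omega_\infty,\mathcal{A}_\infty,\mathbb{P}_\infty)\to\mathbb{R}$ be another real random variable on a probability space. Suppose that all the $X_n$ and $X_\infty$ have (finite) moments of all orders, that the probability law of $X_\infty$ is determined by its moments, and that $$\forall j\geq 1,\quad \mathbb{E}_{\mathbb{P}_n}\big(X_n^j\big)\to \mathbb{E}_{\mathbb{P}_\infty}\big(X_\infty^j\big)\quad\text{as } n\to+\infty.$$ Then $X_n$ converges weakly to $X_\infty$ as $n\to+\infty$, i.e., $\mathbb{E}_{\mathbb{P}_n} f(X_n)\to\mathbb{E}_{\mathbb{P}_\infty} f(X_\infty)$ for every bounded continuous function $f:\mathbb{R}\to\mathbb{R}$.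
   Context: A random variable $X$ has moments of all orders if $\mathbb{E}|X|^j<\infty$ for all $j\geq 1$. The law of $X_\infty$ is determined by its moments if every probability measure $\nu$ on the Borel sets of $\mathbb{R}$ having moments of all orders and satisfying $\int x^j\,d\nu(x)=\mathbb{E}_{\mathbb{P}_\infty}(X_\infty^j)$ for all $j\geq 1$ equals the law of $X_\infty$. *)

(* Defs.v *)
From HB Require Import structures.
From mathcomp Require Import all_boot all_order all_algebra.
From mathcomp Require Import all_classical all_reals all_analysis.

Set Implicit Arguments.
Unset Strict Implicit.
Unset Printing Implicit Defensive.

Import Order.TTheory GRing.Theory Num.Theory.
Import numFieldNormedType.Exports.

Local Open Scope classical_set_scope.
Local Open Scope ring_scope.

Definition moments_of_all_orders (d : measure_display) (T : measurableType d)
    (R : realType) (P : probability T R) (X : {RV P >-> R}) : Prop :=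
  forall j : nat, (1 <= j)%N -> ('E_P[fun w => (`|X w : R| ^+ j)%R] < +oo)%E.

(* The equality of laws is only required on Borel sets: a measure is here a
   function on all subsets, whose values on nonmeasurable sets are junk. *)
Definition law_determined_by_moments (d : measure_display)
    (T : measurableType d) (R : realType) (P : probability T R)
    (X : {RV P >-> R}) : Prop :=
  forall nu : probability R R,
    (forall j : nat, (1 <= j)%N -> (\int[nu]_x (`|x| ^+ j)%:E < +oo)%E) ->
    (forall j : nat, (1 <= j)%N ->
       (\int[nu]_x (x ^+ j)%:E = 'E_P[fun w => (X w ^+ j)%R])%E) ->
    forall A : set R, measurable A ->
      nu A = distribution P X A.

Definition cvg_weakly (R : realType)
    (d : nat -> measure_display) (T : forall n, measurableType (d n))
    (P : forall n, probability (T n) R) (X : forall n, {RV (P n) >-> R})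
    (doo : measure_display) (Too : measurableType doo)
    (Poo : probability Too R) (Xoo : {RV Poo >-> R}) : Prop :=
  forall f : R -> R, continuous f -> bounded_fun f ->
    ('E_(P n)[fun w => f (X n w)] @[n --> \oo] -->
     'E_Poo[fun w => f (Xoo w)])%E.

(* Main.v *)
(* Fix an ultrafilter U on the indices. The distribution functions of the laws
   mu_n converge pointwise along U to a nondecreasing function G, and a uniform
   bound on the second moments (tightness) makes the right limits of G the
   distribution function of a probability nu. Along U, the integrals of every
   continuous function of polynomial growth converge to its nu-integral, by
   truncation and the bounds on higher moments. In particular nu has the moments
   of the limit law, so it is that law by determinacy. As this holds for every U
   finer than the Frechet filter, the whole sequence converges. *)

Require Import Defs.
From HB Require Import structures.
From mathcomp Require Import all_boot all_order all_algebra.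
From mathcomp Require Import all_classical all_reals all_analysis.
From mathcomp Require Import measurable_realfun.
From mathcomp Require Import ring lra.
Set Implicit Arguments.
Unset Strict Implicit.
Unset Printing Implicit Defensive.
Import Order.TTheory GRing.Theory Num.Theory.
Import numFieldNormedType.Exports.
Local Open Scope classical_set_scope.
Local Open Scope ring_scope.

(** * Ultrafilter convergence and uniform continuity on segments *)

(** The image of [U] under [u] is an ultrafilter containing the compact segment [[-C, C]], hence it
    converges. *)
Lemma ultra_cvg_bounded (T : Type) (R : realType) (U : set_system T)
    (UU : UltraFilter U) (u : T -> R) (C : R) :
  (\forall n \near U, `|u n| <= C) -> cvg (u @ U).
Proof.
move=> uC.
have := @segment_compact R (- C) C; rewrite compact_ultra => /(_ (u @ U)).
have UuU : UltraFilter (u @ U).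
  split; first exact: fmap_proper_filter.
  move=> G GG UG; apply/seteqP; split => [A GA|]//.
  have [//|nUA] := pselect ((u @ U) A).
  have UnA : U (u @^-1` (~` A)) by have [] := in_ultra_setVsetC (u @^-1` A) UU.
  by have [x []] := filter_ex (filterI GA (UG _ UnA)).
move=> /(_ UuU)[|l [_ ul]]; last by apply/cvg_ex; exists l.
by near=> n; rewrite /= in_itv/= -ler_norml; near: n.
Unshelve. all: by end_near. Qed.

(** If the preimage of some neighbourhood of [l] were not in [F], its complement [B] could be added
    to [F] to form a proper filter; an ultrafilter refining it would contain both [B] and the
    complement of [B]. *)
Lemma cvg_ultra (T : Type) (V : topologicalType) (F : set_system T)
    (FF : ProperFilter F) (u : T -> V) (l : V) :
  (forall U, UltraFilter U -> F `<=` U -> u @ U --> l) -> u @ F --> l.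
Proof.
move=> ul A lA; have [//|nFA] := pselect ((u @ F) A).
pose B := u @^-1` (~` A).
have [|U [UU FU]] := @ultraFilterLemma _ (within B F).
  apply: Build_ProperFilter_ex => P FP; apply: contrapT => nP; apply: nFA.
  apply: (@filterS _ F _ _ _ _ FP) => x BP; apply: contrapT => nAx; apply: nP.
  by exists x; exact: BP.
have FsubU : F `<=` U.
  by move=> P FP; apply: FU; apply: filterS FP.
have UA := ul U UU FsubU A lA.
have UB : U B by apply: FU; apply: nearW.
by have [x []] := filter_ex (filterI UA UB).
Qed.

(** Compactness in its near-covering form turns the radii found at each point into one radius for
    the whole segment. Only [x] is confined to the segment. *)
Lemma heine_segment (R : realType) (f : R -> R) (a b e : R) :
  continuous f -> 0 < e ->
  exists2 d, 0 < d & forall x y, x \in `[a, b] -> `|x - y| < d ->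
    `|f x - f y| < e.
Proof.
move=> cf e0.
have /compact_near_coveringP/near_covering_withinP cK := @segment_compact R a b.
have := cK _ (0:R)^'+ (fun d x => forall y, `|x - y| < d -> `|f x - f y| < e) _.
case.
  move=> x _.
  (* Halving the radius [r] keeps both [z], within [r / 2] of [x], and [y], within [r / 2] of [z],
     in the ball where [f] is [e / 2]-close to [f x]. *)
  have /cvgrPdist_lt/(_ (e / 2))/(_ _)/nbhs_ballP[|r/= r0 fr] := cf x.
    by rewrite divr_gt0.
  exists (ball x (r / 2), [set d | d < r / 2]).
    split => /=; first by apply: nbhsx_ballx; rewrite divr_gt0.
    by apply: nbhs_right_lt; rewrite divr_gt0.
  move=> [z d]/= [xz dr] zab y zy.
  have fz : `|f x - f z| < e / 2.
    apply: fr => /=; apply: lt_trans xz _; lra.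
  have fy : `|f x - f y| < e / 2.
    apply: fr; rewrite /ball/=.
    have := ler_distD z x y; move: xz; rewrite /ball/=; lra.
  have := ler_distD (f x) (f z) (f y); rewrite (distrC (f z) (f x)); lra.
move=> r/= r0 fr; exists (r / 2); first by rewrite divr_gt0.
move=> x y xab xy; apply: (fr (r / 2)) => //=.
- by rewrite /ball/= sub0r normrN gtr0_norm ?divr_gt0//; lra.
- by rewrite divr_gt0.
Qed.

(** * Distribution functions and Helly selection along an ultrafilter *)

Definition real_cdf (R : realType) (mu : probability R R) (x : R) : R :=
  fine (mu `]-oo, x]%classic).

Lemma real_cdf_ge0 (R : realType) (mu : probability R R) x : 0 <= real_cdf mu x.
Proof. by rewrite fine_ge0. Qed.

Lemma real_cdf_le1 (R : realType) (mu : probability R R) x : real_cdf mu x <= 1.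
Proof.
rewrite -lee_fin fineK ?fin_num_measure//.
by apply: probability_le1.
Qed.

Lemma real_cdf_nondecreasing (R : realType) (mu : probability R R) :
  {homo real_cdf mu : x y / x <= y}.
Proof.
move=> x y xy; apply: fine_le; rewrite ?fin_num_measure//.
by apply: le_measure; rewrite ?inE//; apply: subset_itvl.
Qed.

(* The values of [G] and the distribution function of [nu] may differ at the
   jumps of [G]; the sandwich below avoids speaking of continuity points. *)
Lemma helly_ultra (R : realType) (mu : nat -> probability R R)
    (U : set_system nat) (UU : UltraFilter U) :
  (forall e, 0 < e -> exists M, \forall n \near U,
     real_cdf (mu n) (- M) <= e /\ 1 - e <= real_cdf (mu n) M) ->
  exists (nu : probability R R) (G : R -> R),
    (forall x, real_cdf (mu n) x @[n --> U] --> G x) /\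
    (forall x y, x < y -> G x <= real_cdf nu x <= G y).
Proof.
move=> tight.
have cvgF x : cvg (real_cdf (mu n) x @[n --> U]).
  apply: (@ultra_cvg_bounded _ _ _ _ _ 1); apply: nearW => n.
  by rewrite ger0_norm ?real_cdf_ge0// real_cdf_le1.
pose G x := lim (real_cdf (mu n) x @[n --> U]).
have FG x : real_cdf (mu n) x @[n --> U] --> G x by exact: cvgF.
have G0 x : 0 <= G x.
  by apply: limr_ge => //; apply: nearW => n; exact: real_cdf_ge0.
have G1 x : G x <= 1.
  by apply: limr_le => //; apply: nearW => n; exact: real_cdf_le1.
have Gnd x y : x <= y -> G x <= G y.
  move=> xy; apply: (ler_cvg_to (FG x) (FG y)); apply: nearW => n.
  exact: real_cdf_nondecreasing.
(* [G] is nondecreasing but need not be right continuous; the infimum of its values strictly to the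
   right of [x] is its right limit there. *)
pose A x := [set G y | y in [set y | x < y]].
have A0 x : A x !=set0 by exists (G (x + 1)), (x + 1) => //=; rewrite ltrDl.
have lA x : has_lbound (A x) by exists 0 => _ [y _ <-].
have iA x : has_inf (A x) by split.
pose F x := inf (A x).
have FleG x y : x < y -> F x <= G y.
  by move=> xy; apply: ge_inf => //; exists y.
have GleF x : G x <= F x.
  by apply: lb_le_inf => // _ [y/= xy <-]; exact/Gnd/ltW.
have Fnd : {homo F : x y / x <= y}.
  move=> x y xy; apply: lb_le_inf => // _ [z/= yz <-].
  by apply: FleG; exact: le_lt_trans yz.
have Frc : right_continuous F.
  move=> x; apply/cvgrPdist_le => e e0.
  have [_ [y/= xy <-] Gy] := inf_adherent e0 (iA x).
  near=> z; rewrite ler0_norm ?subr_le0//; last first.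
    by apply: Fnd; near: z; exact: nbhs_right_ge.
  rewrite opprB lerBlDl; apply: (le_trans _ (ltW Gy)); apply: FleG.
  by near: z; exact: nbhs_right_lt.
(* Tightness passes to [G], so that no mass escapes to infinity and the limit is a probability. *)
have FNy : F @ -oo --> (0:R).
  apply/cvgrPdist_le => e e0; have [M nM] := tight e e0.
  near=> z; rewrite sub0r normrN ger0_norm ?(le_trans (G0 z))//.
  apply: (@le_trans _ _ (G (- M))).
    by apply: FleG; near: z; exact: (nbhs_ninfty_lt (num_real _)).
  by apply: limr_le => //; apply: filterS nM => n [].
have Fy : F @ +oo --> (1:R).
  apply/cvgrPdist_le => e e0; have [M nM] := tight e e0.
  near=> z.
  rewrite ger0_norm ?subr_ge0 ?(le_trans (FleG z (z + 1) _))// ?ltrDl//.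
  rewrite lerBlDl -lerBlDr; apply: (@le_trans _ _ (G M)); last first.
    apply: (le_trans _ (GleF z)); apply: Gnd; near: z.
    exact: (nbhs_pinfty_ge (num_real _)).
  by apply: limr_ge => //; apply: filterS nM => n [].
pose cumF := isCumulative.Build R _ R F Fnd Frc.
pose bndF := isCumulativeBounded.Build R 0 1 F FNy Fy.
pose F' : cumulativeBounded (0:R) (1:R) := HB.pack F cumF bndF.
(* The Lebesgue-Stieltjes measure lives on [measurableTypeR R]; its image under the identity is a
   probability on [R]. *)
pose idTR : measurableTypeR R -> R := idfun.
pose idm := @isMeasurableFun.Build _ _ _ _ idTR (@measurable_id _ _ setT).
pose Id : {RV (lebesgue_stieltjes_measure F') >-> R} := HB.pack idTR idm.
exists (distribution (lebesgue_stieltjes_measure F') Id), G; split => // x y xy.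
suff -> : real_cdf (distribution (lebesgue_stieltjes_measure F') Id) x = F x.
  by rewrite GleF FleG.
by have /(congr1 fine) := cdf_lebesgue_stieltjes_id F' x.
Unshelve. all: by end_near. Qed.

(** * Step approximation and integrals of compactly supported functions *)

Lemma continuous_le_integrable (R : realType) (mu : probability R R)
    (f g : R -> R) :
  continuous f -> mu.-integrable setT (EFin \o g) ->
  (forall x, `|f x| <= g x) -> mu.-integrable setT (EFin \o f).
Proof.
move=> cf ig fg; apply: (le_integrable _ _ _ ig) => //.
  by apply/measurable_EFinP; exact: continuous_measurable_fun.
by move=> x _ /=; rewrite lee_fin (le_trans (fg x))// ler_norm.
Qed.

Lemma probability_integrable_cst (R : realType) (mu : probability R R) (K : R) :
  mu.-integrable setT (EFin \o cst K).
Proof. exact: finite_measure_integrable_cst. Qed.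

Lemma Rintegral_probability_cst (R : realType) (mu : probability R R) (K : R) :
  \int[mu]_x K = K.
Proof.
rewrite Rintegral_cst//; have := probability_setT mu => /(congr1 fine) ->.
by rewrite mulr1.
Qed.

Lemma Rintegral_dist_le (R : realType) (mu : probability R R) (f g h : R -> R) :
  mu.-integrable setT (EFin \o f) -> mu.-integrable setT (EFin \o g) ->
  mu.-integrable setT (EFin \o h) -> (forall x, `|f x - g x| <= h x) ->
  `|\int[mu]_x f x - \int[mu]_x g x| <= \int[mu]_x h x.
Proof.
move=> fi gi hi fgh; rewrite -RintegralB//.
have fgi : mu.-integrable setT (EFin \o (f \- g)).
  rewrite [X in _.-integrable _ X](_ : _ = (EFin \o f) \- (EFin \o g))%E//.
  exact: integrableB.
apply: le_trans (le_normr_Rintegral _ fgi) _ => //.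
apply: le_Rintegral => //; first by have := integrable_norm fgi.
by move=> x _; exact: fgh.
Qed.

(** Written through its jumps, so that its integral involves only tails beyond the grid points. For
    a nondecreasing grid, its value on []q i, q i.+1]] with [i < N] is [f (q i.+1) - f (q 0)]. *)
Definition step_fun (R : realType) (f : R -> R) (q : nat -> R) (N : nat)
  (x : R) : R :=
  \sum_(i < N) (f (q i.+1) - f (q i)) * \1_(`]q i, +oo[%classic) x.

Lemma step_fun_approx (R : realType) (f : R -> R) (q : nat -> R) (N : nat)
    (e : R) (x : R) :
  {homo q : i j / (i <= j)%N >-> i <= j} -> 0 <= e ->
  (forall i y, (i < N)%N -> q i <= y <= q i.+1 -> `|f y - f (q i.+1)| <= e) ->
  (forall y, y <= q 0%N -> f y = 0) -> (forall y, q N <= y -> f y = 0) ->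
  `|f x - step_fun f q N x| <= e.
Proof.
move=> qnd e0 fe f0 fN.
have indE i : \1_(`]q i, +oo[%classic) x = (q i < x)%R%:R :> R.
  by rewrite indicE mem_setE in_itv/= andbT.
have full n : (forall i, (i < n)%N -> q i < x) ->
    step_fun f q n x = f (q n) - f (q 0%N).
  move=> qn; rewrite -(telescope_sumr (fun i => f (q i)))//.
  by rewrite big_mkord; apply: eq_bigr => i _; rewrite indE qn// mulr1.
have [xq0|q0x] := leP x (q 0%N).
  rewrite (f0 _ xq0) /step_fun big1 ?subrr ?normr0// => i _.
  by rewrite indE ltNge (le_trans xq0) ?mulr0// qnd.
have fq0 : f (q 0%N) = 0 by exact: f0.
have [xqN|qNx] := leP x (q N); last first.
  rewrite (fN _ (ltW qNx)) full ?fq0 ?fN// ?subrr ?normr0// => i iN.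
  by rewrite (le_lt_trans _ qNx)// qnd// ltnW.
(* Induction on [N] locates the cell containing [x]; [fN] is cleared because it does not descend to
   a shorter grid. *)
elim: N xqN fe {fN} => [|n IH] xqN fe; first by move: q0x; rewrite ltNge xqN.
have [xn|nx] := leP x (q n).
  rewrite /step_fun big_ord_recr/= indE ltNge xn mulr0 addr0.
  by apply: IH => // i y iN; apply: fe; exact: leqW.
rewrite full ?fq0 ?subr0 ?fe ?(ltW nx)// => i iN.
by rewrite (le_lt_trans _ nx)// qnd.
Qed.

Lemma integrable_step_fun (R : realType) (mu : probability R R) (f : R -> R)
    (q : nat -> R) (N : nat) :
  mu.-integrable setT (EFin \o step_fun f q N).
Proof.
rewrite [X in _.-integrable _ X](_ : _ = fun x => (\sum_(i < N)
  ((f (q i.+1) - f (q i)) * \1_(`]q i, +oo[%classic) x)%:E)%E); last first.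
  by apply/funext => x /=; rewrite /step_fun sumEFin.
apply: integrable_sum => // i _.
rewrite [X in _.-integrable _ X](_ : _ = fun x => ((f (q i.+1) - f (q i))%:E *
  (\1_(`]q i, +oo[%classic) x)%:E)%E); last by [].
apply: integrableZl => //; exact: integrable_indic.
Qed.

Lemma Rintegral_step_fun (R : realType) (mu : probability R R) (f : R -> R)
    (q : nat -> R) (N : nat) :
  \int[mu]_x step_fun f q N x =
  \sum_(i < N) (f (q i.+1) - f (q i)) * (1 - real_cdf mu (q i)).
Proof.
elim: N => [|N IH].
  rewrite big_ord0; under eq_Rintegral do rewrite /step_fun big_ord0.
  by rewrite Rintegral_cst// mul0r.
rewrite big_ord_recr/= -IH.
have recr x : step_fun f q N.+1 x =
    step_fun f q N x + (f (q N.+1) - f (q N)) * \1_(`]q N, +oo[%classic) x.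
  by rewrite /step_fun big_ord_recr.
rewrite (eq_Rintegral _ (fun x _ => recr x)).
have iI : mu.-integrable setT (EFin \o \1_(`]q N, +oo[%classic)).
  exact: integrable_indic.
have iZ : mu.-integrable setT
    (EFin \o fun x => (f (q N.+1) - f (q N)) * \1_(`]q N, +oo[%classic) x).
  by have := integrableZl measurableT (f (q N.+1) - f (q N)) iI.
rewrite RintegralD//; last exact: integrable_step_fun.
rewrite RintegralZl//; congr (_ + _ * _).
rewrite /Rintegral integral_indic// setIT /real_cdf.
have -> : `]q N, +oo[%classic = ~` `]-oo, q N]%classic :> set R.
  by rewrite setCitvl.
have mI : measurable (`]-oo, q N]%classic : set R) by [].
have := probability_setC mu mI => /(congr1 fine) ->.
by rewrite fineB ?fin_num_measure.
Qed.

(* Abel summation turns the defect between [G] and the distribution function of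
   [nu] at the grid points into a telescoping sum, so that no grid of continuity
   points has to be chosen. *)
Lemma cvg_Rintegral_compact_support (R : realType) (mu : nat -> probability R R)
    (nu : probability R R) (G : R -> R) (U : set_system nat)
    (UU : ProperFilter U) (f : R -> R) (M : R) :
  (forall x, real_cdf (mu n) x @[n --> U] --> G x) ->
  (forall x y, x < y -> G x <= real_cdf nu x <= G y) ->
  continuous f -> 0 < M -> (forall x, M <= `|x| -> f x = 0) ->
  \int[mu n]_x f x @[n --> U] --> \int[nu]_x f x.
Proof.
move=> FG GF cf M0 fM.
have [K fK] : exists K, forall x, `|f x| <= K.
  have cnf : continuous (fun x => `|f x|).
    by move=> x; exact: (cvg_norm (cf x)).
  have MM : - M <= M by lra.
  have [c _ fc] := EVT_max MM (continuous_subspaceT cnf).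
  exists `|f c| => x; have [xM|Mx] := leP `|x| M.
    by apply: fc; rewrite in_itv/= -ler_norml.
  by rewrite fM ?normr0// ltW.
have fint (m : probability R R) : m.-integrable setT (EFin \o f).
  exact: continuous_le_integrable cf (probability_integrable_cst m K) fK.
apply/cvgrPdist_le => e e0.
(* The four quarters pay for the step approximation under [mu n], the same under [nu], the passage
   from [G] to the distribution function of [nu], and the convergence of the finite sums. *)
have e40 : 0 < e / 4 by rewrite divr_gt0.
have [d d0 fd] := heine_segment (- M) M cf e40.
have [N Nd] : exists N : nat, 2 * M / N.+1%:R < d.
  exists (Num.bound (2 * M / d)).
  rewrite ltr_pdivrMr// [ltRHS]mulrC -ltr_pdivrMr//.
  apply: (@lt_trans _ _ (Num.bound (2 * M / d))%:R).
    by rewrite archi_boundP// ltW// divr_gt0// mulr_gt0.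
  by rewrite ltr_nat.
pose h := 2 * M / N.+1%:R.
have h0 : 0 < h by rewrite divr_gt0// mulr_gt0.
pose q (i : nat) : R := - M + i%:R * h.
have qS i : q i.+1 = q i + h by rewrite /q -addn1 natrD; ring.
have qlt i : q i < q i.+1 by rewrite qS ltrDl.
have qnd : {homo q : i j / (i <= j)%N >-> i <= j}.
  by move=> i j ij; rewrite /q lerD2l ler_pM2r// ler_nat.
have q0 : q 0%N = - M by rewrite /q mul0r addr0.
have qN : q N.+1 = M by rewrite /q /h mulrC divfK ?pnatr_eq0//; ring.
have fosc i y : (i < N.+1)%N -> q i <= y <= q i.+1 ->
    `|f y - f (q i.+1)| <= e / 4.
  move=> iN /andP[iy yi]; apply: ltW; apply: fd.
    rewrite in_itv/= -q0 -qN; apply/andP; split.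
      by apply: le_trans iy; exact: qnd.
    by apply: (le_trans yi); exact: qnd.
  by rewrite -/h in Nd; rewrite qS in yi *; rewrite ler0_norm; lra.
have approx (m : probability R R) :
    `|\int[m]_x f x - \int[m]_x step_fun f q N.+1 x| <= e / 4.
  apply: le_trans (Rintegral_dist_le (fint m) (integrable_step_fun m f q N.+1)
    (probability_integrable_cst m (e / 4)) _) _.
    move=> x; apply: step_fun_approx => //; first exact: ltW.
      by move=> y; rewrite q0 => yM; apply: fM; rewrite ler0_norm; lra.
    by move=> y; rewrite qN => yM; apply: fM; rewrite ger0_norm; lra.
  by rewrite Rintegral_probability_cst.
pose S (H : R -> R) := \sum_(i < N.+1) (f (q i.+1) - f (q i)) * (1 - H (q i)).
(* At [q i] both functions take values between [G (q i)] and [G (q i.+1)], and the coefficients are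
   at most [e / 4]; the increments of [G] sum to at most 1. *)
have SG : `|S G - S (real_cdf nu)| <= e / 4.
  rewrite /S -sumrB.
  apply: (@le_trans _ _ (\sum_(i < N.+1) e / 4 * (G (q i.+1) - G (q i)))).
    apply: le_trans (ler_norm_sum _ _ _) _; apply: ler_sum => i _.
    rewrite -mulrBr normrM.
    have /andP[GF1 GF2] := GF _ _ (qlt i).
    apply: ler_pM => //; first by rewrite distrC fosc// lexx qnd.
    by rewrite ger0_norm; lra.
  rewrite -mulr_sumr -[leRHS]mulr1 ler_pM2l//.
  rewrite -(big_mkord xpredT (fun i => G (q i.+1) - G (q i))).
  rewrite (telescope_sumr (fun i => G (q i)))//.
  have G0 x : 0 <= G x.
    by apply: (cvgr_to_ge (FG x)); apply: nearW => n; exact: real_cdf_ge0.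
  have G1 x : G x <= 1.
    by apply: (cvgr_to_le (FG x)); apply: nearW => n; exact: real_cdf_le1.
  by have := G0 (q 0%N); have := G1 (q N.+1); lra.
have Scvg : S (real_cdf (mu n)) @[n --> U] --> S G.
  apply: cvg_big => [|i _].
    by move=> x; exact: add_continuous.
  by apply: cvgMl_tmp; apply: cvgB; [exact: cvg_cst|exact: FG].
have /cvgrPdist_le/(_ _ e40) := Scvg.
apply: filterS => n SnG.
have := approx nu; have := approx (mu n); rewrite !Rintegral_step_fun.
rewrite -/(S (real_cdf nu)) -/(S (real_cdf (mu n))).
move: SG SnG; rewrite !ler_norml => /andP[? ?] /andP[? ?] /andP[? ?] /andP[? ?].
by apply/andP; split; lra.
Qed.

(** * A quadratic cutoff function *)

(** A quadratic profile makes the loss [1 - cutoff M x] at most [x ^+ 2 / M ^+ 2], so that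
    truncation errors are bounded by moments. *)
Definition cutoff (R : realType) (M x : R) : R :=
  Num.max 0 (1 - x ^+ 2 / M ^+ 2).

Lemma cutoff_ge0 (R : realType) (M x : R) : 0 <= cutoff M x.
Proof. by rewrite le_max lexx. Qed.

Lemma cutoff_le1 (R : realType) (M x : R) : cutoff M x <= 1.
Proof. by rewrite ge_max ler01 gerBl divr_ge0// sqr_ge0. Qed.

Lemma cutoff_out (R : realType) (M x : R) :
  0 < M -> M <= `|x| -> cutoff M x = 0.
Proof.
move=> M0 Mx; rewrite /cutoff max_l// subr_le0 ler_pdivlMr ?exprn_gt0// mul1r.
by rewrite -(real_normK (num_real x)) ler_sqr ?nnegrE// ltW.
Qed.

Lemma cutoff_ge_onem (R : realType) (M x : R) :
  1 - x ^+ 2 / M ^+ 2 <= cutoff M x.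
Proof. by rewrite le_max lexx orbT. Qed.

Lemma cutoff_continuous (R : realType) (M : R) : continuous (cutoff M).
Proof.
move=> x.
have -> : cutoff M =
  (cst 0 : R -> R^o) \max (fun x : R => 1 - x ^+ 2 / M ^+ 2) by [].
apply: continuous_max; first exact: cvg_cst.
apply: cvgB; first exact: cvg_cst.
by apply: cvgMr_tmp; exact: exprn_continuous.
Qed.

Lemma cutoff_homo (R : realType) (x : R) :
  {in Num.pos &, {homo (fun M => cutoff M x) : M N / M <= N}}.
Proof.
move=> M N; rewrite !posrE => M0 N0 MN; rewrite /cutoff ge_max le_max lexx/=.
rewrite le_max lerD2l lerN2 ler_wpM2l ?sqr_ge0 ?orbT//.
rewrite lef_pV2 ?posrE ?exprn_gt0//.
by apply: lerXn2r => //; rewrite nnegrE ltW.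
Qed.

Lemma cvg_cutoff (R : realType) (x : R) :
  cutoff m.+1%:R x @[m --> \oo] --> (1:R).
Proof.
(* Since [m.+1 ^ 2] is at least [m.+1], the harmonic sequence suffices for the lower bound. *)
apply: (@squeeze_cvgr _ _ _ R (fun m : nat => 1 - x ^+ 2 * m.+1%:R^-1) (cst 1)).
- apply: nearW => m /=; rewrite cutoff_le1 andbT.
  apply: le_trans (cutoff_ge_onem _ _).
  rewrite lerD2l lerN2 ler_wpM2l ?sqr_ge0//.
  by rewrite lef_pV2 ?posrE ?exprn_gt0// expr2 ler_peMr// ler1n.
- rewrite -[X in _ --> X]subr0; apply: cvgB; first exact: cvg_cst.
  rewrite -[X in _ --> X](mulr0 (x ^+ 2)).
  by apply: cvgMl_tmp; exact: cvg_harmonic.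
- exact: cvg_cst.
Qed.

(** * Truncation errors, tails and moments of the limit *)

Definition has_moments (R : realType) (mu : probability R R) : Prop :=
  forall j : nat, mu.-integrable setT (EFin \o fun x => x ^+ j).

(** The integrand of the difference is at most [x ^+ 2 / M ^+ 2] times [K * (1 + x ^+ k.*2)], a
    combination of the two moments bounded by [C]. *)
Lemma Rintegral_cutoff_dist (R : realType) (mu : probability R R) (f : R -> R)
    (K C M : R) (k : nat) :
  has_moments mu -> continuous f -> 0 < M -> 0 <= K ->
  (forall x, `|f x| <= K * (1 + x ^+ k.*2)) ->
  \int[mu]_x (x ^+ 2) <= C -> \int[mu]_x (x ^+ k.+1.*2) <= C ->
  `|\int[mu]_x f x - \int[mu]_x (cutoff M x * f x)| <= K * (C + C) / M ^+ 2.
Proof.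
move=> mom cf M0 K0 fK C2 Ck.
have gi : mu.-integrable setT (EFin \o fun x => K * (1 + x ^+ k.*2)).
  have := integrableD measurableT (probability_integrable_cst mu 1) (mom k.*2).
  by move=> /(integrableZl measurableT K).
have fi := continuous_le_integrable cf gi fK.
have ci : mu.-integrable setT (EFin \o fun x => cutoff M x * f x).
  apply: continuous_le_integrable gi _.
    by move=> x; apply: cvgM; [exact: cutoff_continuous|exact: cf].
  move=> x; rewrite normrM (ger0_norm (cutoff_ge0 _ _)).
  by rewrite (le_trans _ (fK x))// ler_piMl// cutoff_le1.
have hi : mu.-integrable setT (EFin \o fun x => x ^+ 2 + x ^+ k.+1.*2).
  by have := integrableD measurableT (mom 2%N) (mom k.+1.*2).
have hZi : mu.-integrable setT
    (EFin \o fun x => K / M ^+ 2 * (x ^+ 2 + x ^+ k.+1.*2)).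
  by have := integrableZl measurableT (K / M ^+ 2) hi.
apply: le_trans (Rintegral_dist_le fi ci hZi _) _.
  move=> x; rewrite -{1}(mul1r (f x)) -mulrBl normrM.
  rewrite ger0_norm ?subr_ge0 ?cutoff_le1//.
  have -> : K / M ^+ 2 * (x ^+ 2 + x ^+ k.+1.*2) =
      x ^+ 2 / M ^+ 2 * (K * (1 + x ^+ k.*2)).
    by rewrite doubleS -[k.*2.+2]add2n exprD; ring.
  apply: ler_pM => //; first by rewrite subr_ge0 cutoff_le1.
  by have := cutoff_ge_onem M x; lra.
rewrite RintegralZl// (RintegralD _ (mom 2%N) (mom _))//.
by rewrite mulrAC ler_wpM2r ?invr_ge0 ?sqr_ge0// ler_wpM2l// lerD.
Qed.

(** Chebyshev's inequality: the indicators of both tails are dominated by [x ^+ 2 / M ^+ 2]. *)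
Lemma real_cdf_tail (R : realType) (mu : probability R R) (M C : R) :
  has_moments mu -> 0 < M -> \int[mu]_x (x ^+ 2) <= C ->
  real_cdf mu (- M) <= C / M ^+ 2 /\ 1 - C / M ^+ 2 <= real_cdf mu M.
Proof.
move=> mom M0 C2.
have m2 := mom 2%N.
have m2Z : mu.-integrable setT (EFin \o fun x => (M ^+ 2)^-1 * x ^+ 2).
  by have := integrableZl measurableT (M ^+ 2)^-1 m2.
have Ci : \int[mu]_x ((M ^+ 2)^-1 * x ^+ 2) <= C / M ^+ 2.
  by rewrite RintegralZl// mulrC ler_wpM2r// invr_ge0 sqr_ge0.
have cdfE x : real_cdf mu x = \int[mu]_y (\1_(`]-oo, x]%classic) y).
  by rewrite /Rintegral integral_indic// setIT.
have iI x : mu.-integrable setT (EFin \o \1_(`]-oo, x]%classic)).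
  exact: integrable_indic.
have out x : M <= `|x| -> 1 <= (M ^+ 2)^-1 * x ^+ 2.
  move=> Mx; rewrite mulrC ler_pdivlMr ?exprn_gt0// mul1r.
  by rewrite -(real_normK (num_real x)) ler_sqr ?nnegrE// ltW.
split.
  apply: le_trans Ci; rewrite cdfE; apply: le_Rintegral => // x _.
  rewrite indicE mem_setE in_itv/=.
  have [xM|_] := leP x (- M).
    by apply: out; rewrite ler0_norm; lra.
  by rewrite mulr_ge0// ?sqr_ge0// invr_ge0 sqr_ge0.
rewrite lerBlDr -lerBlDl; apply: le_trans Ci.
rewrite -{1}(Rintegral_probability_cst mu 1) cdfE -RintegralB//; last first.
  exact: probability_integrable_cst.
apply: le_Rintegral => //.
  by have := integrableB measurableT (probability_integrable_cst mu 1) (iI M).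
move=> x _; rewrite indicE mem_setE in_itv/=.
have [xM|Mx] := leP x M.
  by rewrite subrr mulr_ge0// ?sqr_ge0// invr_ge0 sqr_ge0.
by rewrite subr0; apply: out; rewrite ger0_norm; lra.
Qed.

(* Truncating [f] at height [M] costs [O(1 / M ^+ 2)] uniformly in the measure,
   by the bound on the moment of order [k.+1.*2]. *)
Lemma cvg_Rintegral_polynomial_growth (R : realType)
    (mu : nat -> probability R R) (nu : probability R R) (G : R -> R)
    (U : set_system nat) (UU : ProperFilter U) (f : R -> R) (K C : R)
    (k : nat) :
  (forall x, real_cdf (mu n) x @[n --> U] --> G x) ->
  (forall x y, x < y -> G x <= real_cdf nu x <= G y) ->
  (forall n, has_moments (mu n)) -> has_moments nu ->
  (\forall n \near U, \int[mu n]_x (x ^+ 2) <= C /\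
                      \int[mu n]_x (x ^+ k.+1.*2) <= C) ->
  \int[nu]_x (x ^+ 2) <= C -> \int[nu]_x (x ^+ k.+1.*2) <= C ->
  continuous f -> 0 <= K -> (forall x, `|f x| <= K * (1 + x ^+ k.*2)) ->
  \int[mu n]_x f x @[n --> U] --> \int[nu]_x f x.
Proof.
move=> FG GF mom nmom Cn Cnu2 Cnuk cf K0 fK.
apply/cvgrPdist_le => e e0.
have C0 : 0 <= C.
  by apply: le_trans Cnu2; apply: Rintegral_ge0 => x _; exact: sqr_ge0.
pose D := K * (C + C).
have D0 : 0 <= D by rewrite mulr_ge0// addr_ge0.
have e30 : 0 < e / 3 by rewrite divr_gt0.
(* As [M] is at least 1 and at least [D / (e / 3)], so is [M ^+ 2], and each truncation error is at
   most [e / 3]. *)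
pose M := 1 + D / (e / 3).
have M1 : 1 <= M by rewrite lerDl divr_ge0// ltW.
have M0 : 0 < M by rewrite (lt_le_trans ltr01).
have DM : D / M ^+ 2 <= e / 3.
  rewrite ler_pdivrMr ?exprn_gt0// mulrC -ler_pdivrMr//.
  apply: (@le_trans _ _ M); first by rewrite /M; lra.
  by rewrite expr2 ler_peMr// ltW.
have ccf : continuous (fun x => cutoff M x * f x).
  by move=> x; apply: cvgM; [exact: cutoff_continuous|exact: cf].
have := cvg_Rintegral_compact_support UU FG GF ccf M0 _.
have cM x : M <= `|x| -> cutoff M x * f x = 0.
  by move=> Mx; rewrite cutoff_out// mul0r.
move=> /(_ cM)/cvgrPdist_le/(_ _ e30) cc.
have nnu := Rintegral_cutoff_dist nmom cf M0 K0 fK Cnu2 Cnuk.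
apply: filterS2 cc Cn => n cc [Cn2 Cnk].
have nmu := Rintegral_cutoff_dist (mom n) cf M0 K0 fK Cn2 Cnk.
move: cc (le_trans nnu DM) (le_trans nmu DM); rewrite !ler_norml.
move=> /andP[? ?] /andP[? ?] /andP[? ?]; apply/andP; split; lra.
Qed.

(** A Fatou-type argument: truncated moments have compactly supported integrands, so they pass to
    the limit along [U] and keep the bound [C]; monotone convergence then removes the cutoff. *)
Lemma even_power_integrable_limit (R : realType)
    (mu : nat -> probability R R) (nu : probability R R) (G : R -> R)
    (U : set_system nat) (UU : ProperFilter U) (C : R) (k : nat) :
  (forall x, real_cdf (mu n) x @[n --> U] --> G x) ->
  (forall x y, x < y -> G x <= real_cdf nu x <= G y) ->
  (forall n, has_moments (mu n)) ->
  (\forall n \near U, \int[mu n]_x (x ^+ k.*2) <= C) ->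
  nu.-integrable setT (EFin \o fun x => x ^+ k.*2) /\
  \int[nu]_x (x ^+ k.*2) <= C.
Proof.
move=> FG GF mom Cn.
have xk0 (x : R) : 0 <= x ^+ k.*2 by rewrite exprn_even_ge0// odd_double.
have ccf (M : R) : continuous (fun x => cutoff M x * x ^+ k.*2).
  by move=> x; apply: cvgM; [exact: cutoff_continuous|exact: exprn_continuous].
have cint (m : probability R R) M : 0 < M ->
    m.-integrable setT (EFin \o fun x => cutoff M x * x ^+ k.*2).
  move=> M0; apply: continuous_le_integrable (ccf M)
    (probability_integrable_cst m (M ^+ k.*2)) _ => x.
  rewrite ger0_norm ?mulr_ge0 ?cutoff_ge0//.
  have [Mx|xM] := leP M `|x|.
    by rewrite cutoff_out// mul0r exprn_ge0// ltW.
  apply: (@le_trans _ _ (x ^+ k.*2)); first by rewrite ler_piMl// cutoff_le1.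
  rewrite -[leLHS]ger0_norm// normrX.
  by apply: lerXn2r; rewrite ?nnegrE// ltW.
have bound (m : nat) : (\int[nu]_x (cutoff m.+1%:R x * x ^+ k.*2)%:E <= C%:E)%E.
  have m0 : (0:R) < m.+1%:R by [].
  have fin := integrable_fin_num measurableT (cint nu _ m0).
  rewrite -(fineK fin) lee_fin.
  apply: (cvgr_to_le
    (cvg_Rintegral_compact_support UU FG GF (ccf m.+1%:R) m0 _)).
    by move=> x mx; rewrite cutoff_out// mul0r.
  apply: filterS Cn => n; apply: le_trans.
  apply: le_Rintegral => //; [exact: cint|exact: mom|move=> x _].
  by rewrite ler_piMl// cutoff_le1.
have lim_le : (\int[nu]_x (x ^+ k.*2)%:E <= C%:E)%E.
  have := @cvg_monotone_convergence _ _ _ nu setT measurableT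
    (fun m x => (cutoff m.+1%:R x * x ^+ k.*2)%:E) _ _ _.
  have limE x : limn (fun m : nat => (cutoff m.+1%:R x * x ^+ k.*2)%:E) =
      (x ^+ k.*2)%:E.
    apply/cvg_lim => //; apply: cvg_EFin; first exact: nearW.
    rewrite -[X in _ --> X]mul1r; apply: cvgMr_tmp; exact: cvg_cutoff.
  under eq_integral do rewrite limE.
  move=> mono; apply: (cvge_to_le (mono _ _ _)).
  - by move=> m; apply/measurable_EFinP; apply: continuous_measurable_fun.
  - by move=> m x _; rewrite lee_fin mulr_ge0// cutoff_ge0.
  - move=> x _ m n mn; rewrite lee_fin ler_wpM2r//.
    by apply: cutoff_homo; rewrite ?posrE// ler_nat ltnS.
  - exact: nearW.
have int : nu.-integrable setT (EFin \o fun x => x ^+ k.*2).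
  apply/integrableP; split.
    apply/measurable_EFinP; apply: continuous_measurable_fun.
    exact: exprn_continuous.
  apply: le_lt_trans (ltry C); apply: le_trans lim_le.
  rewrite le_eqVlt; apply/orP; left; apply/eqP.
  by apply: eq_integral => x _ /=; rewrite ger0_norm.
split => //.
by rewrite -lee_fin fineK// integrable_fin_num.
Qed.

(** * The method of moments for laws on the line *)

Lemma frechet_shohat (R : realType) (mu : nat -> probability R R)
    (nu0 : probability R R) :
  (forall n, has_moments (mu n)) -> has_moments nu0 ->
  (forall nu : probability R R, has_moments nu ->
    (forall j, \int[nu]_x (x ^+ j) = \int[nu0]_x (x ^+ j)) ->
    forall A, measurable A -> nu A = nu0 A) ->
  (forall j, \int[mu n]_x (x ^+ j) @[n --> \oo] --> \int[nu0]_x (x ^+ j)) ->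
  forall f : R -> R, continuous f -> bounded_fun f ->
  \int[mu n]_x f x @[n --> \oo] --> \int[nu0]_x f x.
Proof.
move=> mom mom0 det cvgm f cf bf.
apply: cvg_ultra => U UU ooU.
have cvgU j : \int[mu n]_x (x ^+ j) @[n --> U] --> \int[nu0]_x (x ^+ j).
  by move=> B /cvgm; exact: ooU.
(* One more than the limit moment, hence a bound for the moments of order [j] that holds eventually
   along [U]. *)
pose c j := \int[nu0]_x (x ^+ j) + 1.
have near_le j : \forall n \near U, \int[mu n]_x (x ^+ j) <= c j.
  have /cvgrPdist_le/(_ _ ltr01) := cvgU j; apply: filterS => n.
  by rewrite /c ler_norml => /andP[]; lra.
have c20 : 0 < c 2%N.
  by rewrite ltr_wpDl// Rintegral_ge0// => x _; exact: sqr_ge0.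
have [e e0|nu [G [FG GF]]] := @helly_ultra _ mu U UU.
  exists (1 + c 2%N / e); apply: filterS (near_le 2%N) => n n2.
  have M1 : 1 <= 1 + c 2%N / e by rewrite lerDl divr_ge0// ltW.
  have M0 : 0 < 1 + c 2%N / e by rewrite (lt_le_trans ltr01).
  have Me : c 2%N / (1 + c 2%N / e) ^+ 2 <= e.
    rewrite ler_pdivrMr ?exprn_gt0// mulrC -ler_pdivrMr//.
    apply: (@le_trans _ _ (1 + c 2%N / e)); first by lra.
    by rewrite expr2 ler_peMr// ltW.
  have [h1 h2] := real_cdf_tail (mom n) M0 n2.
  split; first exact: le_trans Me.
  by apply: le_trans h2; rewrite lerD2l lerN2.
have even k : nu.-integrable setT (EFin \o fun x => x ^+ k.*2) /\
    \int[nu]_x (x ^+ k.*2) <= c k.*2.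
  exact: even_power_integrable_limit FG GF mom (near_le k.*2).
(* Dominating every power by an even one reduces integrability under [nu] to the even moments. *)
have le1sq (t : R) : `|t| <= 1 + t ^+ 2.
  by rewrite ler_norml; apply/andP; split; nra.
have powle (j : nat) (x : R) : `|x ^+ j| <= 1 * (1 + x ^+ j.*2).
  by rewrite mul1r -muln2 exprM; exact: le1sq.
have nmom : has_moments nu.
  move=> j; have [i2 _] := even j.
  have i1 : nu.-integrable setT (EFin \o fun x => 1 * (1 + x ^+ j.*2)).
    under [X in _.-integrable _ X]eq_fun do rewrite mul1r.
    by have := integrableD measurableT (probability_integrable_cst nu 1) i2.
  by apply: continuous_le_integrable i1 (powle j); exact: exprn_continuous.
have growth (g : R -> R) K k : continuous g -> 0 <= K ->
    (forall x, `|g x| <= K * (1 + x ^+ k.*2)) ->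
    \int[mu n]_x g x @[n --> U] --> \int[nu]_x g x.
  move=> cg K0 gK.
  apply: (@cvg_Rintegral_polynomial_growth _ mu nu G U _ g K
    (Num.max (c 2%N) (c k.+1.*2)) k) => //.
  - apply: filterS2 (near_le 2%N) (near_le k.+1.*2) => n h2 hk.
    by rewrite !le_max h2 hk orbT.
  - by have [_ h] := even 1%N; rewrite le_max h.
  - by have [_ h] := even k.+1; rewrite le_max h orbT.
(* The moments along [U] tend both to those of [nu] and to those of [nu0]; uniqueness of limits
   makes determinacy applicable. *)
have nuE A : measurable A -> nu A = nu0 A.
  apply: det => // j.
  have := growth (fun x => x ^+ j) 1 j (@exprn_continuous _ j) ler01 (powle j).
  by move=> h; apply: cvg_unique h (cvgU j).
have -> : \int[nu0]_x f x = \int[nu]_x f x.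
  rewrite /Rintegral; congr fine.
  by apply: eq_measure_integral => A mA _; apply/esym/nuE.
have [K [_ /(_ (K + 1))]] := bf.
rewrite ltrDl ltr01 => /(_ isT) fK.
(* A bounded function is the case [k = 0] of polynomial growth; the absolute value provides the
   required nonnegative constant. *)
apply: (growth f `|K + 1| 0%N) => // x.
rewrite (le_trans (fK x I))// (le_trans (ler_norm _))// ler_peMr//.
by rewrite lerDl.
Qed.

(** * From laws back to random variables *)

(** Change of variables. Integrability ensures that the extended-real expectation is finite, so that
    taking [fine] on the right loses nothing. *)
Lemma expectation_integrable_distribution (d : measure_display)
    (T : measurableType d) (R : realType) (P : probability T R)
    (X : {RV P >-> R}) (g : R -> R) :
  continuous g -> (distribution P X).-integrable setT (EFin \o g) ->
  ('E_P[fun w => g (X w)])%E = (\int[distribution P X]_x g x)%:E.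
Proof.
move=> cg ig; have mg : measurable_fun [set: R] (EFin \o g).
  by apply/measurable_EFinP; exact: continuous_measurable_fun.
have iP : P.-integrable setT ((EFin \o g) \o X).
  apply/integrableP; split; first exact: measurableT_comp.
  have /integrableP[_] := ig.
  rewrite ge0_integral_distribution//; exact: measurableT_comp.
rewrite unlock -(integral_distribution mg iP) /Rintegral fineK//.
exact: integrable_fin_num.
Qed.

Lemma has_moments_distribution (d : measure_display)
    (T : measurableType d) (R : realType) (P : probability T R)
    (X : {RV P >-> R}) :
  moments_of_all_orders X -> has_moments (distribution P X).
Proof.
(* Order 0 lies outside the assumption on moments and is the integral of the constant 1. *)
move=> mom [|j]; first exact: (probability_integrable_cst _ 1).
have mX k : measurable_fun [set: R] (EFin \o fun x : R => x ^+ k).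
  apply/measurable_EFinP; apply: continuous_measurable_fun.
  exact: exprn_continuous.
apply/integrableP; split => //.
rewrite ge0_integral_distribution//; last exact: measurableT_comp.
have := mom j.+1 isT; rewrite unlock.
by under eq_integral do rewrite -normrX.
Qed.

Theorem theorem3 (R : realType)
    (d : nat -> measure_display) (Omega : forall n, measurableType (d n))
    (P : forall n, probability (Omega n) R) (X : forall n, {RV (P n) >-> R})
    (doo : measure_display) (Omegaoo : measurableType doo)
    (Poo : probability Omegaoo R) (Xoo : {RV Poo >-> R})
    (HX : forall n, (1 <= n)%N -> moments_of_all_orders (X n))
    (HXoo : moments_of_all_orders Xoo)
    (Hdet : law_determined_by_moments Xoo)
    (Hcvg : forall j : nat, (1 <= j)%N ->
      ('E_(P n)[fun w => (X n w ^+ j)%R] @[n --> \oo] -->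
       'E_Poo[fun w => (Xoo w ^+ j)%R])%E) :
  cvg_weakly X Xoo.
Proof.
move=> f cf bf.
(* Moments are assumed from index 1 on, hence the shift; [cvg_shiftS] carries the limits across
   it. *)
pose mu n : probability R R := distribution (P n.+1) (X n.+1).
pose nu0 : probability R R := distribution Poo Xoo.
have mom n : has_moments (mu n) by apply: has_moments_distribution; exact: HX.
have mom0 : has_moments nu0 by exact: has_moments_distribution.
have powE n j : 'E_(P n.+1)[fun w => (X n.+1 w ^+ j)%R]%E =
    (\int[mu n]_x (x ^+ j))%:E.
  apply: (@expectation_integrable_distribution _ _ _ _ (X n.+1)
    (fun x => x ^+ j)).
    exact: exprn_continuous.
  exact: mom.
have powooE j : 'E_Poo[fun w => (Xoo w ^+ j)%R]%E = (\int[nu0]_x (x ^+ j))%:E.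
  apply: (@expectation_integrable_distribution _ _ _ _ Xoo (fun x => x ^+ j)).
    exact: exprn_continuous.
  exact: mom0.
have det (nu : probability R R) : has_moments nu ->
    (forall j, \int[nu]_x (x ^+ j) = \int[nu0]_x (x ^+ j)) ->
    forall A, measurable A -> nu A = nu0 A.
  move=> nmom nuE; apply: Hdet => j j1.
    have /integrableP[_] := nmom j.
    by under eq_integral do rewrite /= normrX.
  rewrite powooE -nuE /Rintegral fineK//.
  exact: (integrable_fin_num measurableT (nmom j)).
have cvgm j : \int[mu n]_x (x ^+ j) @[n --> \oo] --> \int[nu0]_x (x ^+ j).
  case: j => [|j].
    under eq_cvg do rewrite (Rintegral_probability_cst (mu _) 1).
    rewrite (Rintegral_probability_cst nu0 1); exact: cvg_cst.
  have := Hcvg j.+1 isT; rewrite -cvg_shiftS powooE => /fine_cvg.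
  by under eq_cvg do rewrite /= powE.
have [K [_ /(_ (K + 1))]] := bf.
rewrite ltrDl ltr01 => /(_ isT) fK.
have fint (m : probability R R) : m.-integrable setT (EFin \o f).
  apply: continuous_le_integrable cf (probability_integrable_cst m (K + 1)) _.
  by move=> x; exact: fK.
have fE n : 'E_(P n.+1)[fun w => f (X n.+1 w)]%E = (\int[mu n]_x f x)%:E.
  exact: expectation_integrable_distribution cf (fint (mu n)).
have fooE : 'E_Poo[fun w => f (Xoo w)]%E = (\int[nu0]_x f x)%:E.
  exact: expectation_integrable_distribution cf (fint nu0).
rewrite -cvg_shiftS fooE (eq_cvg _ _ fE).
apply: cvg_EFin; first exact: nearW.
exact: frechet_shohat mom mom0 det cvgm f cf bf.
Qed.
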